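(* Let $(a_n)_{n\ge 1}$ be the sequence of all positive integers that are sums of two squares (i.e. of the form $r^2+t^2$ with $r,t\in\mathbb{Z}$), listed in strictly increasing order. Then $(a_n)_{n\ge 1}$ does not have metric Poissonian pair correlation.
   Context: For real $x$, $\|x\|$ denotes the distance from $x$ to the nearest integer. A strictly increasing sequence $(a_n)_{n\ge1}$ of positive integers has metric Poissonian pair correlation (MPPC) if and only if for almost every $\alpha\in[0,1)$ (with respect to Lebesgue measure) and all $s\ge 0$, $$\frac{1}{N}\#\left\{(m,n) : 1\le m\ne n\le N,\ \|(a_m-a_n)\alpha\|\le \frac{s}{N}\right\}\longrightarrow 2s\quad\text{as } N\to\infty.$$ *)

(* Defs.v *)
From mathcomp Require Import all_boot all_order all_algebra.
From mathcomp Require Import all_classical all_reals all_analysis.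

Set Implicit Arguments.
Unset Strict Implicit.
Unset Printing Implicit Defensive.

Import Order.TTheory GRing.Theory Num.Theory.
Import numFieldNormedType.Exports.

Local Open Scope classical_set_scope.
Local Open Scope ring_scope.

Definition dist_int (R : realType) (x : R) : R :=
  inf [set `|x - m%:~R| | m in [set: int]].

(* Sequences are indexed from 0: [a n] stands for the term a_{n+1}, so the
   index range 1 <= m, n <= N becomes 'I_N. *)
Definition pair_count (R : realType) (a : nat -> nat) (alpha s : R) (N : nat) :
    nat :=
  #|[set p : 'I_N * 'I_N | (p.1 != p.2) &&
      (dist_int (((a p.1)%:R - (a p.2)%:R) * alpha) <= s / N%:R)]%SET|.

(* Meaningful for strictly increasing sequences of positive integers. *)
Definition mppc (R : realType) (a : nat -> nat) : Prop :=
  {ae @lebesgue_measure R, forall alpha : R, 0 <= alpha < 1 ->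
    forall s : R, 0 <= s ->
      (fun N : nat => (pair_count a alpha s N)%:R / N%:R : R) @ \oo
        --> (2 * s : R)}.

Definition sum_of_two_squares (k : nat) : Prop :=
  exists r t : int, k%:Z = r ^+ 2 + t ^+ 2.

Definition enumerates (a : nat -> nat) (A : set nat) : Prop :=
  {homo a : m n / (m < n)%N} /\ range a = A.

(* Main.v *)
(** Write [Q = 4^(k+1)], [N = 16 Q]. By Cauchy-Schwarz over residue classes, any
    [N] integers contain at least [16 N] ordered pairs congruent modulo a given
    [q <= Q]. Hence if [alpha] lies within [1 / (N a_N)] of a fraction [r / q] with
    [q <= Q], at least [15 N] pairs satisfy [||(a_m - a_n) alpha|| <= 1 / N], far
    more than the Poissonian [2 N]. A Khintchine-type argument (reduced fractions
    are well separated, so their neighbourhoods at different levels are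
    quasi-independent) shows that such [alpha] recur at infinitely many levels on a
    set of positive measure as soon as [sum 1 / a_n] diverges. For sums of two
    squares the divergence follows from factorization in Z[i]: every nonzero
    Gaussian integer is [i^j m w(b) conj(w(c))] with [w] completely multiplicative
    and [b], [c] sums of two squares, so that
    [sum_z 1 / |z|^2 <= 4 (sum 1 / m^2) (sum 1 / a_n)^2], whose left side diverges. *)

Require Import Defs.
From mathcomp Require Import all_boot all_order all_algebra all_field.
From mathcomp Require Import all_classical all_reals all_analysis.
From mathcomp Require Import ring lra zify.

Import Order.TTheory GRing.Theory Num.Theory.
Import numFieldNormedType.Exports.

Local Open Scope classical_set_scope.
Local Open Scope ring_scope.

(** * Divergence of the sum of inverses of sums of two squares *)

Lemma floor_sqrt (n : nat) : exists k : nat, (k * k <= n < k.+1 * k.+1)%N.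
Proof.
elim: n => [|n [k /andP[k1 k2]]]; first by exists 0%N.
have [h|h] := ltnP n.+1 (k.+1 * k.+1)%N; first by exists k; lia.
exists k.+1; nia.
Qed.

(** Thue's argument: if [p] divides [u x + v y] with [u], [v] small and not both zero, then
    [u^2 + v^2] is a positive multiple of [p] below [2 p], hence equal to [p]. *)
Lemma prime_sum_two_squares (p : nat) (x y : int) :
  prime p -> (p%:Z %| x ^+ 2 + y ^+ 2)%Z -> ~~ (p%:Z %| x)%Z ->
  exists c d : int, c ^+ 2 + d ^+ 2 = p%:Z.
Proof.
move=> pp pxy npx; have p0 := prime_gt0 pp; have p1 := prime_gt1 pp.
have [k /andP[kp pk]] := floor_sqrt p.
(* A prime is not a square; this strictness later gives [u^2 + v^2 < 2 p]. *)
have {}kp : (k * k < p)%N.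
  rewrite ltn_neqAle kp andbT; apply/eqP => kpE.
  have /(prime_nt_dvdP pp) : (k %| p)%N by rewrite -kpE dvdn_mulr.
  move=> h; have : k = p by apply: h; apply/eqP; nia.
  nia.
(* Thue: two of the [(k + 1)^2 > p] values [a x + b y] agree modulo [p]. *)
have fP (ab : 'I_k.+1 * 'I_k.+1) :
    (`|((ab.1%:Z * x + ab.2%:Z * y)%R %% p%:Z)%Z|%N < p)%N.
  have := @ltz_pmod (ab.1%:Z * x + ab.2%:Z * y) p%:Z.
  have := @modz_ge0 (ab.1%:Z * x + ab.2%:Z * y) p%:Z. lia.
pose f ab := Ordinal (fP ab).
have /injectivePn [[a b] [[a' b'] nab fab]] : ~~ injectiveb f.
  apply/negP => /injectiveP /leq_card.
  by rewrite card_prod !card_ord leqNgt pk.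
pose u := a%:Z - a'%:Z; pose v := b%:Z - b'%:Z.
have puv : (p%:Z %| u * x + v * y)%Z.
  have /eqP : ((a%:Z * x + b%:Z * y)%R = (a'%:Z * x + b'%:Z * y)%R %[mod p%:Z])%Z.
    move: fab => /(congr1 val) /=.
    have := @modz_ge0 (a%:Z * x + b%:Z * y) p%:Z.
    have := @modz_ge0 (a'%:Z * x + b'%:Z * y) p%:Z. lia.
  rewrite eqz_mod_dvd; congr (_ %| _)%Z; rewrite /u /v; ring.
have px : coprimez p%:Z (x ^+ 2).
  by rewrite coprimezXr // /coprimez /gcdz; rewrite -[_ == _]/(coprime _ _) prime_coprime.
have puv2 : (p%:Z %| u ^+ 2 + v ^+ 2)%Z.
  rewrite -(Gauss_dvdzl _ px).
  have -> : (u ^+ 2 + v ^+ 2) * x ^+ 2 =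
    (u * x + v * y) * (u * x - v * y) + (x ^+ 2 + y ^+ 2) * v ^+ 2 by ring.
  by rewrite rpredD // dvdz_mulr.
have uv0 : 0 < u ^+ 2 + v ^+ 2.
  rewrite lt_neqAle addr_ge0 ?sqr_ge0 // andbT eq_sym paddr_eq0 ?sqr_ge0 //.
  rewrite !sqrf_eq0 !subr_eq0 !eqz_nat; apply: contraNN nab.
  by rewrite xpair_eqE -!val_eqE.
exists u, v; case/dvdzP: puv2 => t tE.
have sq (c c' : 'I_k.+1) : (c%:Z - c'%:Z) ^+ 2 <= k%:Z * k%:Z.
  have := ltn_ord c; have := ltn_ord c'; clear; nia.
have := sq a a'; have := sq b b'; rewrite -/u -/v.
rewrite tE in uv0 *; move: kp p0 uv0 tE; clear => kp p0 uv0 tE ub va.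
have t0 : 0 < t by nia.
have t2 : t < 2 by nia.
have -> : t = 1 by lia.
by rewrite mul1r.
Qed.

(** * Gaussian integers inside [algC] and their factorization *)

Definition gauss (x y : int) : algC := x%:~R + 'i * y%:~R.

Lemma gaussM (x y x' y' : int) :
  gauss x y * gauss x' y' = gauss (x * x' - y * y') (x * y' + y * x').
Proof.
rewrite /gauss rmorphB !rmorphD !rmorphM /= mulrDl !mulrDr.
have -> : 'i * y%:~R * ('i * y'%:~R) = - (y%:~R * y'%:~R) :> algC.
  by rewrite mulrACA -expr2 sqrCi mulN1r.
ring.
Qed.

Lemma conj_gauss (x y : int) : (gauss x y)^* = gauss x (- y).
Proof. by rewrite /gauss rmorphD rmorphM /= conjCi !conj_intr ?intr_int // rmorphN /= mulrN mulNr. Qed.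

Lemma gauss_norm (x y : int) :
  gauss x y * (gauss x y)^* = (x ^+ 2 + y ^+ 2)%:~R.
Proof.
rewrite conj_gauss gaussM /gauss.
have -> : x * - y + y * x = 0 by ring.
by rewrite mulr0 addr0; congr (_%:~R); ring.
Qed.

Lemma gauss_inj (x y x' y' : int) : gauss x y = gauss x' y' -> x = x' /\ y = y'.
Proof.
move=> e; have r (z : int) : (z%:~R : algC) \is Num.real by rewrite realz.
have /= := congr1 (fun z : algC => 'Re z) e; have := congr1 (fun z : algC => 'Im z) e.
rewrite /gauss !Re_rect ?Im_rect ?r // => /intr_inj -> /intr_inj ->; split=> //.
Qed.

Lemma gaussZ (m x y : int) : gauss (m * x) (m * y) = m%:~R * gauss x y.
Proof. by rewrite /gauss !rmorphM /=; ring. Qed.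

(* [pi p] stands for a Gaussian integer of norm [p] when the prime [p] is a sum of
   two squares; [wgauss pi X] is multiplicative on integers whose prime factors
   are at most [X]. *)
Definition wgauss (pi : nat -> int * int) (X b : nat) : algC :=
  \prod_(p < X.+1 | prime p) gauss (pi p).1 (pi p).2 ^+ logn p b.

Lemma wgauss1 (pi : nat -> int * int) (X : nat) : wgauss pi X 1 = 1.
Proof. by rewrite /wgauss big1 // => p _; rewrite logn1 expr0. Qed.

Lemma wgaussM (pi : nat -> int * int) (X p b : nat) :
  prime p -> (p <= X)%N -> (0 < b)%N ->
  wgauss pi X (p * b) = gauss (pi p).1 (pi p).2 * wgauss pi X b.
Proof.
move=> pp pX b0; have pX1 : (p < X.+1)%N by [].
rewrite /wgauss (bigD1 (Ordinal pX1)) //= [in RHS](bigD1 (Ordinal pX1)) //= mulrA.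
congr (_ * _).
  by rewrite lognM ?(prime_gt0 pp) // (logn_prime _ pp) eqxx exprS.
apply: eq_bigr => i /andP[pi' ip].
rewrite lognM ?(prime_gt0 pp) // (logn_prime _ pp); case: eqP => // ip'.
by case/eqP: ip; apply/val_inj.
Qed.

Lemma wgauss_gauss (pi : nat -> int * int) (X b : nat) :
  exists x y : int, wgauss pi X b = gauss x y.
Proof.
apply: (big_ind (fun z => exists x y : int, z = gauss x y)).
- by exists 1, 0; rewrite /gauss mulr0 addr0.
- by move=> _ _ [x [y ->]] [x' [y' ->]]; rewrite gaussM; eexists; eexists.
move=> p _; elim: (logn p b) => [|n [x [y IH]]].
  by exists 1, 0; rewrite /gauss mulr0 addr0.
by rewrite exprS IH gaussM; eexists; eexists.
Qed.

(** Strong induction on the norm [n], splitting off its least prime factor [p]. If [p] divides [x],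
    it divides [y] too and goes into [m]. Otherwise [p] is a sum of two squares, and either [pi p]
    or its conjugate divides [x + i y], so that [p] goes into [b1] or [b2]. The units of norm 1
    account for the power of ['i]. *)
Lemma gauss_factorization (pi : nat -> int * int) (X : nat) :
  (forall p : nat, (exists c d : int, c ^+ 2 + d ^+ 2 = p%:Z) ->
    (pi p).1 ^+ 2 + (pi p).2 ^+ 2 = p%:Z) ->
  forall (n : nat) (x y : int), (0 < n <= X)%N -> x ^+ 2 + y ^+ 2 = n%:Z ->
  exists (j : 'I_4) (m b1 b2 : nat),
    [/\ gauss x y = 'i ^+ j * m%:R * wgauss pi X b1 * (wgauss pi X b2)^*,
        [/\ 0 < m, 0 < b1 & 0 < b2]%N,
        wgauss pi X b1 * (wgauss pi X b1)^* = b1%:R,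
        wgauss pi X b2 * (wgauss pi X b2)^* = b2%:R
      & n = (m ^ 2 * b1 * b2)%N].
Proof.
move=> piP n; elim/ltn_ind: n => n IH x y /andP[n0 nX] xyn.
have [n1|n1] := leqP n 1.
  have nE : n = 1%N by lia.
  suff [j ->] : exists j : 'I_4, gauss x y = 'i ^+ j.
    exists j, 1%N, 1%N, 1%N.
    by rewrite wgauss1 conjC1 !mulr1; split => //; rewrite nE.
  have x1 : -1 <= x <= 1 by nia.
  have y1 : -1 <= y <= 1 by nia.
  have : [\/ x = 1 /\ y = 0, x = 0 /\ y = 1, x = -1 /\ y = 0 | x = 0 /\ y = -1].
    have : x = -1 \/ x = 0 \/ x = 1 by lia.
    have : y = -1 \/ y = 0 \/ y = 1 by lia.
    move=> [|[|]] yE [|[|]] xE; subst x y; (try (exfalso; lia)).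
    + by constructor 4.
    + by constructor 3.
    + by constructor 1.
    + by constructor 2.
  case=> -[-> ->]; rewrite /gauss.
  - by exists ord0; rewrite mulr0 addr0.
  - by exists (inord 1); rewrite inordK // mulr1 add0r.
  - by exists (inord 2); rewrite inordK // sqrCi mulr0 addr0.
  - by exists (inord 3); rewrite inordK // exprS sqrCi add0r.
pose p := pdiv n; have pp : prime p := pdiv_prime n1.
have p0 := prime_gt0 pp; have p1 := prime_gt1 pp.
have pn : (p %| n)%N := pdiv_dvd n.
have pX : (p <= X)%N := leq_trans (dvdn_leq n0 pn) nX.
have pxy : (p%:Z %| x ^+ 2 + y ^+ 2)%Z by rewrite xyn.
have dvd_sq (z : int) : (p%:Z %| z ^+ 2)%Z = (p%:Z %| z)%Z.
  by rewrite !dvdzE abszX Euclid_dvdX // andbT.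
have [px|px] := boolP (p%:Z %| x)%Z.
  have py : (p%:Z %| y)%Z.
    by rewrite -dvd_sq; move: pxy; rewrite rpredDl // dvd_sq.
  case/dvdzP: px => x' xE; case/dvdzP: py => y' yE.
  case/dvdnP: pn => n' nE.
  have E : (x' ^+ 2 + y' ^+ 2) * p%:Z = n'%:Z.
    have pnz : p%:Z != 0 by lia.
    apply: (mulIf pnz); rewrite -[RHS]PoszM -nE -xyn xE yE; ring.
  have : (p%:Z %| n'%:Z)%Z by rewrite -E dvdz_mull.
  rewrite dvdzE => /dvdnP[n'' /= n'E].
  have {}E : x' ^+ 2 + y' ^+ 2 = n''%:Z.
    have pnz : p%:Z != 0 by lia.
    by apply: (mulIf pnz); rewrite E n'E.
  have nE2 : n = (p ^ 2 * n'')%N by rewrite nE n'E; ring.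
  have n''0 : (0 < n'')%N by case: (n'') nE2 n0 => [|//]; rewrite muln0 => ->.
  have n''n : (n'' < n)%N.
    by rewrite nE2 ltn_Pmull // -{1}(exp1n 2) ltn_exp2r.
  have [|j [m [b1 [b2 [e1 [m0 b10 b20] e2 e3 e4]]]]] := IH n'' n''n x' y' _ E.
    by rewrite n''0 (leq_trans (ltnW n''n) nX).
  exists j, (p * m)%N, b1, b2; split => //.
  - rewrite xE yE ![_ * p%:Z]mulrC gaussZ e1 natrM; rewrite -[_%:~R]/(p%:R). ring.
  - by split => //; rewrite muln_gt0 p0.
  - by rewrite nE2 e4; ring.
have [c [d cd]] := prime_sum_two_squares p x y pp pxy px.
have {cd} := piP p (ex_intro _ c (ex_intro _ d cd)).
set c' := (pi p).1; set d' := (pi p).2 => cd.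
case/dvdnP: pn => n' nE.
have n'0 : (0 < n')%N by case: (n') nE n0 => [|//]; rewrite mul0n => ->.
have n'n : (n' < n)%N by rewrite nE ltn_Pmulr.
have pnz : p%:Z != 0 by lia.
have pC : p%:R != 0 :> algC by rewrite pnatr_eq0 -lt0n.
have n'X : (0 < n' <= X)%N by rewrite n'0 (leq_trans (ltnW n'n) nX).
have gp : gauss c' d' * (gauss c' d')^* = p%:R.
  by rewrite gauss_norm cd.
(* Division by [gauss c' e], with [e] either [d'] or [- d']. After multiplication by the conjugate,
   [x c' + y e] is the real part and [y c' - x e] the imaginary part; their squares add up to a
   multiple of [p], so divisibility of the latter gives that of the former. *)
have key (e : int) : e ^+ 2 = d' ^+ 2 -> (p%:Z %| y * c' - x * e)%Z ->
    exists x' y' : int, gauss x y = gauss c' e * gauss x' y' /\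
      x' ^+ 2 + y' ^+ 2 = n'%:Z.
  move=> ed pe; have pe' : (p%:Z %| x * c' + y * e)%Z.
    rewrite -dvd_sq.
    have -> : (x * c' + y * e) ^+ 2 =
      (x ^+ 2 + y ^+ 2) * (c' ^+ 2 + e ^+ 2) - (y * c' - x * e) ^+ 2 by ring.
    by rewrite rpredB // ?dvd_sq // dvdz_mulr.
  case/dvdzP: pe => y' yE; case/dvdzP: pe' => x' xE.
  exists x', y'; split.
    rewrite gaussM; congr gauss; apply: (mulIf pnz).
      have -> : (c' * x' - e * y') * p%:Z = c' * (x' * p%:Z) - e * (y' * p%:Z) by ring.
      rewrite -xE -yE -cd -ed; ring.
    have -> : (c' * y' + e * x') * p%:Z = c' * (y' * p%:Z) + e * (x' * p%:Z) by ring.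
    rewrite -xE -yE -cd -ed; ring.
  apply: (mulIf pnz); apply: (mulIf pnz).
  have -> : (x' ^+ 2 + y' ^+ 2) * p%:Z * p%:Z =
    (x' * p%:Z) ^+ 2 + (y' * p%:Z) ^+ 2 by ring.
  have nEz : n%:Z = n'%:Z * p%:Z by rewrite nE PoszM.
  rewrite -xE -yE -nEz -xyn -cd -ed; ring.
(* The product of the two candidate imaginary parts is divisible by [p], which chooses between
   [pi p] and its conjugate. *)
have : (p%:Z %| (y * c' - x * d') * (y * c' - x * - d'))%Z.
  have -> : (y * c' - x * d') * (y * c' - x * - d') =
    (c' ^+ 2 + d' ^+ 2) * y ^+ 2 - (x ^+ 2 + y ^+ 2) * d' ^+ 2 by ring.
  by rewrite rpredB // dvdz_mulr // cd.
rewrite dvdzE abszM Euclid_dvdM // -!dvdzE => /orP[] h.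
  have [//|x' [y' [E1 E2]]] := key d' _ h.
  have [j [m [b1 [b2 [e1 [m0 b10 b20] e2 e3 e4]]]]] := IH n' n'n x' y' n'X E2.
  exists j, m, (p * b1)%N, b2; split => //.
  - rewrite E1 e1 wgaussM // -/c' -/d'; ring.
  - by split => //; rewrite muln_gt0 p0.
  - by rewrite wgaussM // -/c' -/d' rmorphM /= mulrACA gp e2 natrM.
  - by rewrite nE e4; ring.
have [|x' [y' [E1 E2]]] := key (- d') _ h; first by rewrite sqrrN.
have [j [m [b1 [b2 [e1 [m0 b10 b20] e2 e3 e4]]]]] := IH n' n'n x' y' n'X E2.
exists j, m, b1, (p * b2)%N; split => //.
- rewrite E1 e1 wgaussM // -/c' -/d' rmorphM /= conj_gauss; ring.
- by split => //; rewrite muln_gt0 p0.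
- by rewrite wgaussM // -/c' -/d' rmorphM /= mulrACA gp e3 natrM.
- by rewrite nE e4; ring.
Qed.

(** * Comparison of sums over Gaussian integers with sums of inverses *)

Definition inv_two_squares (R : realType) (b : nat) : R :=
  if (0 < b)%N && `[< sum_of_two_squares b >] then b%:R^-1 else 0.

Lemma inv_two_squares_ge0 (R : realType) (b : nat) : 0 <= inv_two_squares R b.
Proof. by rewrite /inv_two_squares; case: ifP => // _; rewrite invr_ge0. Qed.

Lemma ler_sum_inj (R : numDomainType) (I J : finType) (phi : I -> J) (f : I -> R)
    (g : J -> R) : injective phi -> (forall j, 0 <= g j) ->
  (forall i, f i <= g (phi i)) -> \sum_i f i <= \sum_j g j.
Proof.
move=> inj g0 fg; apply: le_trans (_ : \sum_i g (phi i) <= _).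
  by apply: ler_sum.
rewrite -(big_imset g (in2W inj)) /= [leRHS](bigID (mem [set phi x | x in I]%SET)) /=.
by rewrite lerDl sumr_ge0.
Qed.

Lemma sum_pairM (R : pzSemiRingType) (I J : finType) (f : I -> R) (g : J -> R) :
  \sum_(t : I * J) f t.1 * g t.2 = (\sum_i f i) * (\sum_j g j).
Proof. by rewrite big_distrlr /= pair_bigA. Qed.

(** Telescoping of [1 / d^2 <= 1 / (d - 1/2) - 1 / (d + 1/2)], starting from [1 / (3/2)]. The count
    of reduced fractions below tolerates at most [11 / 16], so the cruder comparison with
    [1 / (d (d - 1))] would not do. *)
Lemma sum_inv_sq_from2 (R : realFieldType) (n : nat) :
  \sum_(2 <= d < n) (d%:R ^+ 2 : R)^-1 <= 2 / 3.
Proof.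
have [n2|/subnK <-] := leqP n 2; first by rewrite big_geq // divr_ge0.
rewrite -addSnnS addn2; move: (n - 3).+1 => {n} n.
suff: \sum_(2 <= d < n.+2) (d%:R ^+ 2 : R)^-1 <= 2 / 3 - (n%:R + 3 / 2)^-1.
  move=> /le_trans; apply; rewrite gerBl invr_ge0.
  by rewrite addr_ge0 // divr_ge0.
elim: n => [|j IH]; first by rewrite big_geq // add0r invf_div subrr.
rewrite big_nat_recr //= (le_trans (lerD IH (lexx _))) //.
have j0 : 0 <= j%:R :> R by [].
have -> : j.+2%:R = j%:R + 2 :> R by rewrite -addn2 natrD.
have -> : j.+1%:R = j%:R + 1 :> R by rewrite -addn1 natrD.
set t := j%:R in j0 *; rewrite -subr_ge0.
have -> : 2 / 3 - (t + 1 + 3 / 2)^-1 - (2 / 3 - (t + 3 / 2)^-1 + ((t + 2) ^+ 2)^-1) =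
   4^-1 / ((t + 3 / 2) * (t + 5 / 2) * (t + 2) ^+ 2).
  by field; do ?(apply/andP; split); apply/eqP; lra.
by rewrite divr_ge0 // !mulr_ge0 // ?sqr_ge0 //; lra.
Qed.

Lemma sum_inv_sq_le2 (R : realFieldType) (n : nat) :
  \sum_(m < n.+1) (m%:R ^+ 2 : R)^-1 <= 2.
Proof.
rewrite -(big_mkord xpredT (fun m => (m%:R ^+ 2 : R)^-1)).
case: n => [|n]; first by rewrite big_nat1 expr0n /= invr0.
rewrite big_ltn // big_ltn // expr0n invr0 /= expr1n invr1 add0r.
have := sum_inv_sq_from2 R n.+2; lra.
Qed.

(** The factorization maps [z] to a tuple [(j, m, b1, b2)]; the map is injective because the tuple
    determines the Gaussian integer, and the inverse norm is the product of the weights. The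
    constant is [4] units times the bound [2] on the sum of [1 / m^2]. *)
Lemma gauss_sum_le (R : realType) (Y : nat) : exists X : nat,
  \sum_(z : 'I_Y * 'I_Y) ((z.1.+1)%:R ^+ 2 + (z.2.+1)%:R ^+ 2 : R)^-1 <=
  8 * (\sum_(b < X.+1) inv_two_squares R b) ^+ 2.
Proof.
pose X := (Y * Y + Y * Y)%N; exists X.
have /choice[pi piP] : forall p : nat, exists cd : int * int,
    (exists c d : int, c ^+ 2 + d ^+ 2 = p%:Z) -> cd.1 ^+ 2 + cd.2 ^+ 2 = p%:Z.
  move=> p; have [[c [d cd]]|np] := pselect (exists c d : int, c ^+ 2 + d ^+ 2 = p%:Z).
    by exists (c, d).
  by exists (0, 0) => /np.
pose T : finType := ('I_4 * ('I_X.+1 * ('I_X.+1 * 'I_X.+1)))%type.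
(* The factor [1] is the weight of the unit coordinate, kept so that [sum_pairM] splits the sum. *)
pose F (t : T) : R :=
  1 * ((t.2.1%:R ^+ 2)^-1 *
    (inv_two_squares R t.2.2.1 * inv_two_squares R t.2.2.2)).
pose G (t : T) : algC := 'i ^+ t.1 * t.2.1%:R * wgauss pi X t.2.2.1 *
  (wgauss pi X t.2.2.2)^*.
(* [wgauss] takes Gaussian integer values, so a norm equal to [b] exhibits [b] as a sum of two
   squares. *)
have w2s b : (0 < b)%N -> wgauss pi X b * (wgauss pi X b)^* = b%:R ->
    inv_two_squares R b = b%:R^-1.
  move=> b0; have [x [y ->]] := wgauss_gauss pi X b.
  rewrite gauss_norm /inv_two_squares b0 /= => e.
  case: asboolP => // -[]; exists x, y.
  by apply: (@intr_inj algC); rewrite e.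
have /choice[phi phiP] (z : 'I_Y * 'I_Y) : exists t : T,
    gauss z.1.+1 z.2.+1 = G t /\
    ((z.1.+1)%:R ^+ 2 + (z.2.+1)%:R ^+ 2 : R)^-1 = F t.
  have zE : (z.1.+1%:Z ^+ 2 + z.2.+1%:Z ^+ 2)%R = (z.1.+1 ^ 2 + z.2.+1 ^ 2)%N%:Z.
    by rewrite PoszD !expr2 -!PoszM.
  have zX : (0 < z.1.+1 ^ 2 + z.2.+1 ^ 2 <= X)%N.
    by rewrite addn_gt0 expn_gt0 /= leq_add // leq_mul.
  have [j [m [b1 [b2 [e1 [m0 b10 b20] e2 e3 e4]]]]] :=
    gauss_factorization pi X piP _ _ _ zX zE.
  case/andP: zX => _ zX; rewrite e4 in zX.
  have mX : (m < X.+1)%N.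
    by rewrite ltnS; apply: leq_trans zX; rewrite -!mulnA leq_pmulr // !muln_gt0 m0 b10.
  have b1X : (b1 < X.+1)%N.
    by rewrite ltnS; apply: leq_trans zX; rewrite mulnAC leq_pmull // !muln_gt0 m0 b20.
  have b2X : (b2 < X.+1)%N.
    by rewrite ltnS; apply: leq_trans zX; rewrite leq_pmull // !muln_gt0 m0 b10.
  exists (j, (Ordinal mX, (Ordinal b1X, Ordinal b2X))); split; first exact: e1.
  rewrite /F /= mul1r w2s // w2s // -!natrX -natrD e4 !natrM !invfM; ring.
have -> : 8 * (\sum_(b < X.+1) inv_two_squares R b) ^+ 2 =
    4 * (2 * (\sum_(b < X.+1) inv_two_squares R b) ^+ 2) by ring.
apply: le_trans (_ : \sum_t F t <= _).
  apply: (@ler_sum_inj _ _ _ phi) => [z z' e||z].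
  - have [e1 _] := phiP z; have [e2 _] := phiP z'.
    have /gauss_inj[] : gauss z.1.+1 z.2.+1 = gauss z'.1.+1 z'.2.+1 by rewrite e1 e2 e.
    case: z z' {e e1 e2} => [x y] [x' y'] /= [xx'] [yy'].
    by congr pair; apply: val_inj.
  - by move=> t; rewrite /F mul1r !mulr_ge0 ?inv_two_squares_ge0 // invr_ge0 exprn_ge0.
  by have [_ ->] := phiP z.
rewrite (@sum_pairM R _ _ (fun=> 1) (fun t : 'I_X.+1 * ('I_X.+1 * 'I_X.+1) => (t.1%:R ^+ 2)^-1 *
    (inv_two_squares R t.2.1 * inv_two_squares R t.2.2))).
rewrite sumr_const card_ord ler_wpM2l //.
rewrite (@sum_pairM R _ _ (fun m : 'I_X.+1 => (m%:R ^+ 2)^-1)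
  (fun t : 'I_X.+1 * 'I_X.+1 => inv_two_squares R t.1 * inv_two_squares R t.2)).
rewrite (@sum_pairM R _ _ (fun b : 'I_X.+1 => inv_two_squares R b)
  (fun b : 'I_X.+1 => inv_two_squares R b)) -expr2.
by rewrite ler_wpM2r ?sqr_ge0 // sum_inv_sq_le2.
Qed.

(** For each [x], the indices [y <= x] contribute [x + 1] terms, each at least
    [1 / (2 (x + 1)^2)]. *)
Lemma gauss_sum_ge (R : realType) (Y : nat) :
  series (@harmonic R) Y / 2 <=
  \sum_(z : 'I_Y * 'I_Y) ((z.1.+1)%:R ^+ 2 + (z.2.+1)%:R ^+ 2 : R)^-1.
Proof.
rewrite -(pair_bigA _ (fun x y : 'I_Y => ((x.+1)%:R ^+ 2 + (y.+1)%:R ^+ 2 : R)^-1)) /=.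
rewrite /series /= big_mkord mulr_suml; apply: ler_sum => x _.
have p0 (n : nat) : 0 < n.+1%:R ^+ 2 :> R by rewrite exprn_gt0.
rewrite (bigID (fun y : 'I_Y => (y < x.+1)%N)) /= ler_wpDr //.
  by apply: sumr_ge0 => y _; rewrite invr_ge0 addr_ge0 // ltW.
apply: le_trans (_ : \sum_(y < Y | (y < x.+1)%N) (2 * x.+1%:R ^+ 2)^-1 <= _).
  rewrite -(big_ord_widen _ (fun=> (2 * x.+1%:R ^+ 2 : R)^-1) (ltn_ord x)).
  rewrite sumr_const card_ord -[leRHS]mulr_natr.
  have x0 : x.+1%:R != 0 :> R by rewrite pnatr_eq0.
  by rewrite le_eqVlt; apply/orP; left; apply/eqP; field.
apply: ler_sum => y yx; rewrite lef_pV2 ?posrE ?addr_gt0 ?mulr_gt0 //.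
by rewrite mulrDl mul1r lerD2l ler_sqr ?nnegrE // ler_nat.
Qed.

Lemma sum_inv_two_squares_unbounded (R : realType) (T : R) :
  exists X : nat, T < \sum_(b < X.+1) inv_two_squares R b.
Proof.
apply: contrapT => /forallNP bT.
have {}bT X : \sum_(b < X.+1) inv_two_squares R b <= T.
  by rewrite leNgt; apply/negP.
apply: (@dvg_harmonic R); apply: nondecreasing_is_cvgn.
  apply/nondecreasing_seqP => n; rewrite /series /= big_nat_recr //=.
  by rewrite lerDl invr_ge0.
exists (2 * (8 * T ^+ 2)) => _ [Y _ <-].
have [X XP] := gauss_sum_le R Y.
have := le_trans (gauss_sum_ge R Y) XP; rewrite ler_pdivrMr // mulrC => /le_trans; apply.
have s0 : 0 <= \sum_(b < X.+1) inv_two_squares R b.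
  by apply: sumr_ge0 => i _; exact: inv_two_squares_ge0.
by rewrite !ler_wpM2l // ler_sqr ?nnegrE // (le_trans s0).
Qed.

(** * Pairs congruent modulo the denominator of a good approximation *)

Lemma homo_ltn_geq (a : nat -> nat) (n : nat) :
  {homo a : m n / (m < n)%N} -> (n <= a n)%N.
Proof. by move=> ha; elim: n => // n IH; apply: leq_ltn_trans IH (ha _ _ _). Qed.

(** Since [n <= a n], every positive sum of two squares up to [X] occurs among the first [X + 1]
    terms; once the double sum is exchanged, each [n] meets at most one [b]. *)
Lemma sum_inv_enum_unbounded (R : realType) (a : nat -> nat) (T : R) :
  enumerates a [set k : nat | (0 < k)%N /\ sum_of_two_squares k] ->
  exists M : nat, T < \sum_(n < M) ((a n)%:R)^-1.
Proof.
case=> ha ra; have [X TX] := sum_inv_two_squares_unbounded R T.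
exists X.+1; apply: lt_le_trans TX _.
apply: le_trans (_ : \sum_(b < X.+1) \sum_(n < X.+1)
    (if a n == b then b%:R^-1 else 0 : R) <= _).
  apply: ler_sum => b _; rewrite /inv_two_squares; case: ifPn => [/andP[b0 /asboolP b2]|_].
    have : [set k : nat | (0 < k)%N /\ sum_of_two_squares k]%classic b by [].
    rewrite -ra => -[n _ nb].
    have nX : (n < X.+1)%N.
      by apply: leq_ltn_trans (homo_ltn_geq a n ha) _; rewrite nb.
    rewrite (bigD1 (Ordinal nX)) //= nb eqxx lerDl sumr_ge0 // => i _.
    by case: ifP => // _; rewrite invr_ge0.
  by rewrite sumr_ge0 // => i _; case: ifP => // _; rewrite invr_ge0.
rewrite exchange_big /=; apply: ler_sum => n _.
have [nX|nX] := ltnP (a n) X.+1.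
  rewrite (bigD1 (Ordinal nX)) //= eqxx big1 ?addr0 // => i /negP ni.
  by case: eqP => // e; case: ni; apply/eqP/val_inj.
rewrite big1 ?invr_ge0 // => i _; case: eqP => // e.
by have := ltn_ord i; rewrite -e ltnNge nX.
Qed.

Lemma dist_int_le (R : realType) (x y : R) (k : int) :
  `|x - k%:~R| <= y -> dist_int x <= y.
Proof.
move=> h; apply: le_trans h; apply: ge_inf; last by exists k.
by exists 0 => _ [m _ <-].
Qed.

(** The count, diagonal included, is the sum of the squares of the class sizes [nc c]. Summing
    [2 C nc <= C^2 + nc^2] over the [q] classes and using [C q <= N] takes the place of
    Cauchy-Schwarz. *)
Lemma card_congr_pairs (a : nat -> nat) (C q N : nat) :
  (0 < q)%N -> (C * q <= N)%N ->
  (C * N <= #|[set p : 'I_N * 'I_N | a p.1 == a p.2 %[mod q]]%SET|)%N.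
Proof.
move=> q0 CqN.
pose nc (c : 'I_q) := (\sum_(m < N) (a m %% q == c))%N.
have sum_nc : (\sum_c nc c = N)%N.
  rewrite exchange_big /= -[RHS]card_ord -sum1_card; apply: eq_bigr => m _.
  rewrite (bigD1 (Ordinal (ltn_pmod (a m) q0))) //= eqxx big1 // => c cm.
  by apply/eqP; rewrite eqb0; apply: contraNN cm => /eqP e; apply/eqP/val_inj.
have -> : #|[set p : 'I_N * 'I_N | a p.1 == a p.2 %[mod q]]%SET| = (\sum_c nc c ^ 2)%N.
  rewrite -sum1_card big_mkcond /=.
  under eq_bigr do rewrite inE.
  rewrite -(pair_bigA _ (fun m n : 'I_N => if a m == a n %[mod q] then 1 else 0)%N) /=.
  under [RHS]eq_bigr => c _ do rewrite /nc expnS expn1 big_distrlr /=.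
  rewrite [RHS]exchange_big /=; apply: eq_bigr => m _.
  rewrite [RHS]exchange_big /=; apply: eq_bigr => n _.
  rewrite (bigD1 (Ordinal (ltn_pmod (a m) q0))) //= eqxx mul1n big1 ?addn0.
    by rewrite eq_sym; case: eqP.
  move=> c cm; have -> : (a m %% q == c)%N = false; last by rewrite mul0n.
  by apply/negbTE; apply: contraNN cm => /eqP e; apply/eqP/val_inj.
have : (\sum_(c < q) 2 * (C * nc c) <= \sum_(c < q) (C ^ 2 + nc c ^ 2))%N.
  by apply: leq_sum => c _; apply: (nat_Cauchy _ _).1.
rewrite [X in (_ <= X)%N]big_split big_const_ord iter_addn addn0 -big_distrr -big_distrr /= sum_nc.
have : (C ^ 2 * q <= C * N)%N by rewrite expnS expn1 -mulnA leq_mul2l CqN orbT.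
move: (\sum_i _)%N (C ^ 2 * q)%N (C * N)%N => S U V; lia.
Qed.

(** If [a m] and [a n] agree modulo [q], then [(a m - a n) r / q] is an integer, and replacing
    [r / q] by [alpha] costs at most [a N / (N * a N) = 1 / N]. The term [+ N] pays for the
    diagonal, absent from [pair_count]. With indices from 0, [a N] is the term just after the [N]
    terms considered and dominates them all. *)
Lemma pair_count_near_rational (R : realType) (a : nat -> nat) (alpha : R)
    (q r C N : nat) :
  {homo a : m n / (m < n)%N} -> (0 < q)%N -> (C * q <= N)%N ->
  `|alpha - r%:R / q%:R| <= (N%:R * (a N)%:R)^-1 ->
  (C * N <= pair_count a alpha 1 N + N)%N.
Proof.
move=> ha q0 CqN near_r; apply: leq_trans (card_congr_pairs a C q N q0 CqN) _.
pose diag := [set (i, i) | i in 'I_N]%SET.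
have diagN : #|diag| = N by rewrite card_imset ?card_ord // => i j [].
rewrite -[X in (_ <= _ + X)%N]diagN /pair_count; set A := [set p | _ && _]%SET.
apply: leq_trans (_ : #|(A :|: diag)%SET| <= _)%N; last exact: (leq_card_setU A diag).1.
apply/subset_leq_card/fintype.subsetP => -[m n].
rewrite !inE /= => mn.
have [<-|mneq] /= := eqVneq m n; first by rewrite imset_f ?orbT.
apply/orP; left.
have N0 : 0 < N%:R :> R by rewrite ltr0n (leq_ltn_trans _ (ltn_ord m)).
have aN (i : 'I_N) : (a i)%:R <= (a N)%:R :> R.
  by rewrite ler_nat ltnW // ha.
have aN0 : 0 < (a N)%:R :> R.
  by rewrite ltr0n (leq_ltn_trans _ (ha _ _ (ltn_ord m))).
have qR : q%:R != 0 :> R by rewrite pnatr_eq0 -lt0n.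
have [t tE] : exists t : int, (a m)%:R - (a n)%:R = q%:R * t%:~R :> R.
  have : (q%:Z %| (a m)%:Z - (a n)%:Z)%Z.
    by rewrite -eqz_mod_dvd !modz_nat.
  case/dvdzP => t tE; exists t.
  have := congr1 (fun z : int => z%:~R : R) tE.
  by rewrite rmorphB rmorphM /= mulrC => ->.
apply: (@dist_int_le _ _ _ (t * r%:Z)).
have -> : ((a m)%:R - (a n)%:R) * alpha - (t * r%:Z)%:~R =
    ((a m)%:R - (a n)%:R) * (alpha - r%:R / q%:R) :> R.
  rewrite mulrBr [in X in _ = _ - X]tE rmorphM /= -[(r%:Z)%:~R]/(r%:R).
  by congr (_ - _); field.
have am : `|(a m)%:R - (a n)%:R| <= (a N)%:R :> R.
  have := aN m; have := aN n; have : 0 <= (a m)%:R :> R by [].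
  have : 0 <= (a n)%:R :> R by [].
  rewrite ler_norml; lra.
rewrite normrM (le_trans (ler_pM _ _ am near_r)) //.
rewrite invfM mulrCA divff ?mulr1 ?mul1r //; exact: lt0r_neq0.
Qed.


(** * Reduced fractions with denominator in ]4^k, 4^(k+1)] *)

(** The lower bound on the denominator keeps different levels disjoint; the upper bound comes from
    the ranges in [fracs]. *)
Definition is_frac (k : nat) (p : nat * nat) : bool :=
  [&& 0 < p.1, p.1 < p.2, 4 ^ k < p.2 & coprime p.1 p.2]%N.

Definition fracs (k : nat) : seq (nat * nat) :=
  [seq p <- [seq (r, q) | r <- index_iota 1 (4 ^ k.+1).+1,
                          q <- index_iota 1 (4 ^ k.+1).+1] | is_frac k p].

Lemma mem_fracs (k : nat) (p : nat * nat) :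
  (p \in fracs k) = is_frac k p && (p.2 <= 4 ^ k.+1)%N.
Proof.
rewrite mem_filter; case: (boolP (is_frac k p)) => //= /and4P[p1 p2 _ _].
case: p p1 p2 => r q /= r0 rq.
apply/allpairsP/idP => [[[r' q'] /= [_ + [_ ->]]]|qQ].
  by rewrite mem_index_iota => /andP[].
exists (r, q) => /=; rewrite !mem_index_iota r0 /= !ltnS qQ (leq_trans (ltnW rq) qQ).
by rewrite (leq_trans _ rq).
Qed.

Lemma fracs_uniq (k : nat) : uniq (fracs k).
Proof.
by rewrite filter_uniq // allpairs_uniq ?iota_uniq // => -[x y] [x' y'] _ _ [-> ->].
Qed.

Lemma size_fracs_le (k : nat) : (size (fracs k) <= (4 ^ k.+1) ^ 2)%N.
Proof.
rewrite size_filter (leq_trans (count_size _ _)) // size_allpairs.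
by rewrite !size_iota subn1 -mulnn.
Qed.

Lemma size_fracs_count (k : nat) :
  ((4 ^ k.+1) ^ 2 <= 2 * size (fracs k) + (4 ^ k) ^ 2 +
    \sum_(2 <= d < (4 ^ k.+1).+1) (4 ^ k.+1 %/ d) ^ 2)%N.
Proof.
(* Each pair [x, y <= Q] is a fraction of the level in one of the two orders, or
   has both entries at most [4^k], or has a common divisor [d >= 2]. *)
set Q := (4 ^ k.+1)%N.
have sumsq (P : pred nat) : ((\sum_(1 <= x < Q.+1) P x) ^ 2 =
    \sum_(1 <= x < Q.+1) \sum_(1 <= y < Q.+1) P x * P y)%N.
  by rewrite -mulnn big_distrlr.
have sizeE : size (fracs k) =
    (\sum_(1 <= x < Q.+1) \sum_(1 <= y < Q.+1) is_frac k (x, y))%N.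
  rewrite size_filter -sum1_count big_mkcond big_allpairs /=.
  by apply: eq_bigr => x _; apply: eq_bigr => y _; case: is_frac.
have c1 : (\sum_(1 <= x < Q.+1) true = Q)%N by rewrite sum_nat_const_nat subn1 muln1.
have c2 : (\sum_(1 <= x < Q.+1) (x <= 4 ^ k) = 4 ^ k)%N.
  have kQ : (4 ^ k <= Q)%N by rewrite leq_exp2l.
  rewrite (big_cat_nat _ (n := (4 ^ k).+1)) //= big_nat_cond.
  rewrite (eq_bigr (fun=> 1%N)) => [|x /andP[/andP[_]]]; last by rewrite ltnS => ->.
  rewrite -big_nat_cond sum_nat_const_nat subn1 muln1 big_nat_cond big1 ?addn0 //.
  by move=> x /andP[/andP[x1 _] _]; apply/eqP; rewrite eqb0 -ltnNge.
rewrite -{1}c1 -{1}c2 !sumsq.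
under [X in (_ <= _ + X)%N]eq_bigr => d _ do rewrite divn_count_dvd sumsq.
rewrite [X in (_ <= _ + X)%N]exchange_big_nat /=.
under [X in (_ <= _ + X)%N]eq_bigr => d _ do rewrite exchange_big_nat /=.
(* One of the two copies of the size is transposed, so that each [(x, y)] is tested in both orders
   and the inequality can be proved term by term. *)
rewrite mul2n -addnn {2}sizeE [X in (_ <= _ + X + _ + _)%N]exchange_big_nat /= sizeE.
rewrite -!big_split /= big_nat_cond [leqRHS]big_nat_cond.
apply: leq_sum => x /andP[/andP[x1 xQ] _].
rewrite -!big_split /= big_nat_cond [leqRHS]big_nat_cond.
apply: leq_sum => y /andP[/andP[y1 yQ] _].
have [cxy|ncxy] := boolP (coprime x y); last first.
  have d2 : (1 < gcdn x y)%N.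
    by rewrite ltn_neqAle gcdn_gt0 x1 andbT eq_sym; exact: ncxy.
  have dQ : (gcdn x y < Q.+1)%N by rewrite (leq_ltn_trans _ xQ) // dvdn_leq // dvdn_gcdl.
  rewrite (bigD1_seq (gcdn x y)) ?mem_index_iota ?d2 ?iota_uniq //=.
  by rewrite dvdn_gcdl dvdn_gcdr addnCA leq_addr.
rewrite (leq_trans _ (leq_addr _ _)) //.
have [x4|x4] := leqP x (4 ^ k); have [y4|y4] := leqP y (4 ^ k).
- by rewrite addn1.
- by rewrite /is_frac /= x1 y4 cxy (leq_ltn_trans x4 y4).
- rewrite /is_frac /= y1 x4 (coprime_sym y) cxy (leq_ltn_trans y4 x4) /=.
  by rewrite addn0 addn1.
rewrite /is_frac /= x1 y1 x4 y4 (coprime_sym y) cxy !andbT !andTb.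
case: ltngtP => // xy; move: cxy; rewrite xy /coprime gcdnn => /eqP y1E.
by move: y4; rewrite y1E ltnNge expn_gt0.
Qed.

(** As [1 - 1/16 - 2/3 = 13/48], twice the size is at least [13/48] of [Q^2], just above
    [Q^2 / 4]. *)
Lemma size_fracs_ge (R : realType) (k : nat) :
  (4 ^ k.+1)%:R ^+ 2 <= 8 * (size (fracs k))%:R :> R.
Proof.
set Q := (4 ^ k.+1)%N.
have h : Q%:R ^+ 2 <= 2 * (size (fracs k))%:R + Q%:R ^+ 2 / 16 +
    \sum_(2 <= d < Q.+1) ((Q %/ d) ^ 2)%:R :> R.
  have -> : Q%:R ^+ 2 / 16 = ((4 ^ k) ^ 2)%:R :> R.
    by rewrite /Q [(4 ^ k.+1)%N]expnS [(4 * _)%:R]natrM [(_ ^ 2)%:R]natrX; field.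
  by rewrite -natrX -natrM -natr_sum -!natrD ler_nat size_fracs_count.
have Q0 : 0 <= Q%:R ^+ 2 :> R by rewrite sqr_ge0.
suff : \sum_(2 <= d < Q.+1) ((Q %/ d) ^ 2)%:R <= Q%:R ^+ 2 * (2 / 3) :> R by lra.
apply: le_trans (ler_wpM2l Q0 (sum_inv_sq_from2 R Q.+1)).
rewrite mulr_sumr big_nat_cond [leRHS]big_nat_cond.
apply: ler_sum => d /andP[/andP[d2 _] _]; have d0 : (0 < d)%N by apply: ltnW.
rewrite natrX -expr_div_n ler_sqr ?nnegrE // ler_pdivlMr ?ltr0n //.
by rewrite -natrM ler_nat leq_divM.
Qed.

Definition frac_val (R : realType) (p : nat * nat) : R := p.1%:R / p.2%:R.

(** For distinct reduced fractions, [r q' - r' q] is a nonzero integer. The case [k = l] makes the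
    intervals of one level disjoint; the case [k < l] controls overlaps between levels. *)
Lemma fracs_sep (R : realType) (k l : nat) (p p' : nat * nat) :
  p \in fracs k -> p' \in fracs l -> p != p' ->
  ((4 ^ k.+1)%:R * (4 ^ l.+1)%:R)^-1 <= `|frac_val R p - frac_val R p'|.
Proof.
rewrite !mem_fracs => /andP[/and4P[p1 p2 _ cp] pk] /andP[/and4P[p1' p2' _ cp'] pl].
case: p p1 p2 cp pk => r q /= r0 rq crq qk; case: p' p1' p2' cp' pl => r' q' /= r0' rq' crq' ql.
move=> ne; have q0 : (0 < q)%N := ltn_trans r0 rq; have q0' : (0 < q')%N := ltn_trans r0' rq'.
have q0R : 0 < q%:R :> R by rewrite ltr0n.
have q0R' : 0 < q'%:R :> R by rewrite ltr0n.
have cross : (r * q' != r' * q)%N.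
  apply: contraNN ne => /eqP e.
  have qq' : (q %| q')%N.
    by rewrite -(Gauss_dvdr q' (n := r)) 1?coprime_sym // e dvdn_mull.
  have q'q : (q' %| q)%N.
    by rewrite -(Gauss_dvdr q (n := r')) 1?coprime_sym // -e dvdn_mull.
  have /eqP qE : (q == q')%N by rewrite eqn_dvd qq' q'q.
  by move: e; rewrite qE => /eqP; rewrite eqn_pmul2r // => /eqP ->.
rewrite /frac_val /=.
have -> : r%:R / q%:R - r'%:R / q'%:R = ((r * q')%:R - (r' * q)%:R) / (q%:R * q'%:R) :> R.
  by rewrite !natrM; field; rewrite !lt0r_neq0.
rewrite normrM normfV [X in _ / X]ger0_norm; last by rewrite mulr_ge0.
apply: le_trans (_ : 1 / (q%:R * q'%:R) <= _).
  rewrite mul1r lef_pV2 ?posrE ?mulr_gt0 ?ltr0n ?expn_gt0 //.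
  by rewrite ler_pM // ler_nat.
rewrite ler_wpM2r ?invr_ge0 ?mulr_ge0 //.
case: ltngtP cross => // c _.
  by rewrite distrC -natrB 1?ltnW // ger0_norm // ler1n subn_gt0.
by rewrite -natrB 1?ltnW // ger0_norm // ler1n subn_gt0.
Qed.

(** The interval of radius [h] about [c] is cut into cells of length [D], none of which holds two of
    the points. *)
Lemma size_separated (R : realType) (T : eqType) (s : seq T) (f : T -> R) (c h D : R) :
  uniq s -> 0 < D -> 0 <= h -> {in s, forall i, `|f i - c| <= h} ->
  {in s &, forall i j, i != j -> D <= `|f i - f j|} ->
  (size s)%:R <= 2 * h / D + 1.
Proof.
move=> us D0 h0 fc sep; have D0' := ltW D0.
pose g i := Num.truncn ((f i - c + h) / D).
have gP i : i \in s -> (g i)%:R <= (f i - c + h) / D < (g i).+1%:R.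
  move=> /fc; rewrite ler_norml => /andP[fc1 fc2]; apply: truncn_itv.
  by rewrite divr_ge0 //; lra.
have gs : uniq (map g s).
  rewrite map_inj_in_uniq // => i j si sj gij; apply/eqP; apply: contraT => ij.
  have := sep i j si sj ij; have := gP i si; have := gP j sj; rewrite gij.
  rewrite ler_pdivlMr // ltr_pdivrMr // -addn1 natrD => /andP[b1 b2].
  rewrite ler_pdivlMr // ltr_pdivrMr // => /andP[b3 b4].
  by rewrite leNgt => /negP[]; rewrite ltr_norml; lra.
have h1 : 0 <= 2 * h / D by rewrite !mulr_ge0 // invr_ge0.
have sub : {subset map g s <= iota 0 (Num.truncn (2 * h / D)).+1}.
  move=> _ /mapP[i si ->]; rewrite mem_iota /= add0n ltnS.
  apply: le_truncn; rewrite ler_wpM2r ?invr_ge0 //.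
  by have := fc i si; rewrite ler_norml => /andP[_]; lra.
have := uniq_leq_size gs sub; rewrite size_map size_iota -(ler_nat R) => /le_trans; apply.
by rewrite -addn1 natrD lerD2r; have /andP[] := truncn_itv h1.
Qed.

(** * Measure of the neighbourhoods of these fractions *)

Lemma measure_bigsetU_le (d : measure_display) (T : measurableType d) (R : realType)
    (mu : {measure set T -> \bar R}) (I : Type) (s : seq I) (A : I -> set T) :
  (forall i, measurable (A i)) ->
  (mu (\big[setU/set0]_(i <- s) A i) <= \sum_(i <- s) mu (A i))%E.
Proof.
move=> mA; elim: s => [|i s IH]; first by rewrite !big_nil measure0.
rewrite !big_cons (le_trans (measureU2 _ _ _)) ?leeD2l //.
exact: bigsetU_measurable.
Qed.

Lemma measure_bigsetU_disjoint (d : measure_display) (T : measurableType d) (R : realType)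
    (mu : {measure set T -> \bar R}) (I : eqType) (s : seq I) (A : I -> set T) :
  (forall i, measurable (A i)) -> uniq s ->
  {in s &, forall i j, i != j -> A i `&` A j = set0} ->
  mu (\big[setU/set0]_(i <- s) A i) = (\sum_(i <- s) mu (A i))%E.
Proof.
move=> mA; elim: s => [|i s IH]; first by rewrite !big_nil measure0.
move=> /= /andP[nis us] dis; rewrite !big_cons measureU //.
- by congr (_ + _)%E; apply: IH => // j l js ls; apply: dis; rewrite inE ?js ?ls orbT.
- exact: bigsetU_measurable.
rewrite big_distrr /= big_seq big1 // => j js; apply: dis; rewrite ?inE ?eqxx ?js ?orbT //.
by apply: contraNneq nis => ->.
Qed.

Lemma measureU_lower (d : measure_display) (T : measurableType d) (R : realType)
    (mu : {measure set T -> \bar R}) (A B : set T) (x y z : R) :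
  measurable A -> measurable B -> (x%:E <= mu A)%E -> (y%:E <= mu B)%E ->
  (mu (A `&` B) <= z%:E)%E -> ((x + y - z)%:E <= mu (A `|` B))%E.
Proof.
move=> mA mB xA yB zAB.
have E : (mu A + mu B <= mu (A `|` B) + z%:E)%E.
  rewrite (measureDI mu mA mB) addeAC -measureU //.
  - by rewrite setUDl setDv setD0 leeD2l.
  - exact: measurableD.
  - by rewrite setIDAC setDv setI0.
have := le_trans (leeD xA yB) E.
have : (0 <= mu (A `|` B))%E by [].
case: (mu _) => [r| |] //=; last by move=> *; rewrite leey.
by rewrite -!EFinD !lee_fin; lra.
Qed.

Definition near_frac (R : realType) (r : R) (p : nat * nat) : set R :=
  `[frac_val R p - r, frac_val R p + r]%classic.

Lemma near_frac_measurable (R : realType) (r : R) (p : nat * nat) :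
  measurable (near_frac R r p).
Proof. exact: measurable_itv. Qed.

Lemma near_frac_measure (R : realType) (r : R) (p : nat * nat) : 0 <= r ->
  lebesgue_measure (near_frac R r p) = (2 * r)%:E.
Proof.
move=> r0; rewrite lebesgue_measure_itv /= lte_fin.
case: ltP => h; first by rewrite -EFinB; congr _%:E; lra.
by congr _%:E; lra.
Qed.

Lemma near_fracE (R : realType) (r : R) (p : nat * nat) (x : R) :
  near_frac R r p x = (`|x - frac_val R p| <= r).
Proof. by rewrite /near_frac /= in_itv /= ler_distl. Qed.

Definition near_fracs (R : realType) (rho : nat -> R) (k : nat) : set R :=
  \big[setU/set0]_(p <- fracs k) near_frac R (rho k) p.

Lemma near_fracsP (R : realType) (rho : nat -> R) (k : nat) (x : R) :
  near_fracs R rho k x <-> exists2 p, p \in fracs k & `|x - frac_val R p| <= rho k.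
Proof.
rewrite /near_fracs -bigcup_seq.
by split => -[p ps xp]; exists p => //; move: xp; rewrite near_fracE.
Qed.

Lemma near_fracs_measurable (R : realType) (rho : nat -> R) (k : nat) :
  measurable (near_fracs R rho k).
Proof. by apply: bigsetU_measurable => p _; exact: near_frac_measurable. Qed.

(** A fraction [r / q] with [0 < r < q <= Q] keeps a distance of at least [1 / Q] from 0 and 1, and
    the hypothesis makes the radius smaller than that. *)
Lemma near_fracs_sub01 (R : realType) (rho : nat -> R) (k : nat) (x : R) :
  rho k * (4 ^ k.+1)%:R ^+ 2 <= 256^-1 -> near_fracs R rho k x -> 0 <= x < 1.
Proof.
move=> drho /near_fracsP[[r q]]; rewrite mem_fracs => /andP[/and4P[/= r0 rq _ _] qQ].
rewrite /frac_val /= ler_distl => /andP[x1 x2].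
have q0 : (0 < q)%N := ltn_trans r0 rq.
set Q := (4 ^ k.+1)%N in drho qQ *.
have Q1 : 1 <= Q%:R :> R by rewrite ler1n expn_gt0.
have q0R : 0 < q%:R :> R by rewrite ltr0n.
have qQR : q%:R <= Q%:R :> R by rewrite ler_nat.
have rqR : r%:R + 1 <= q%:R :> R by rewrite natr1 ler_nat.
have r1R : 1 <= r%:R :> R by rewrite ler1n.
have rhoQ : rho k < Q%:R^-1.
  rewrite -[_^-1]mul1r ltr_pdivlMr; last by lra.
  have [rk|rk] := leP (rho k) 0; first by rewrite (le_lt_trans _ ltr01) // mulr_le0_ge0 //; lra.
  apply: (@le_lt_trans _ _ (rho k * Q%:R ^+ 2)); last by lra.
  by rewrite ler_wpM2l ?(ltW rk) // expr2 ler_peMl //; lra.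
have Qq : Q%:R^-1 <= q%:R^-1 :> R by rewrite lef_pV2 // posrE; lra.
have a1 : q%:R^-1 <= r%:R / q%:R :> R by rewrite ler_peMl // invr_ge0 ltW.
have a2 : r%:R / q%:R + q%:R^-1 <= 1 :> R.
  by rewrite -[X in _ + X]mul1r -mulrDl ler_pdivrMr ?mul1r.
by apply/andP; split; lra.
Qed.

(** Up to constants, the total length of the intervals of level [k]: with [Q = 4^(k+1)] there are
    between [Q^2 / 8] and [Q^2] of them, each of length [2 rho k]. *)
Definition level_mass (R : realType) (rho : nat -> R) (k : nat) : R :=
  rho k * (4 ^ k.+1)%:R ^+ 2.

(** The bound on the mass puts [2 rho k] below the separation [1 / Q^2], so the intervals are
    disjoint and their lengths add up. *)
Lemma near_fracs_measure_ge (R : realType) (rho : nat -> R) (k : nat) :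
  0 < rho k -> level_mass R rho k <= 256^-1 ->
  ((level_mass R rho k / 4)%:E <= lebesgue_measure (near_fracs R rho k))%E.
Proof.
move=> rk mass_small; rewrite /near_fracs measure_bigsetU_disjoint.
- rewrite (eq_bigr (fun=> (2 * rho k)%:E)); last first.
    by move=> p _; apply: near_frac_measure; exact: ltW.
  rewrite sumEFin lee_fin big_const_seq count_predT iter_addr_0 -mulr_natr.
  have := size_fracs_ge R k; move: rk; rewrite /level_mass; nra.
- by move=> p; exact: near_frac_measurable.
- exact: fracs_uniq.
move=> p p' ps ps' pp'; apply/seteqP; split => // x [] /=.
rewrite !near_fracE !ler_distl => /andP[h1 h2] /andP[h3 h4].
have := fracs_sep R k k p p' ps ps' pp'; rewrite leNgt => /negP; apply.
apply: (@le_lt_trans _ _ (2 * rho k)); first by rewrite ler_norml; lra.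
rewrite -[ltRHS]mul1r ltr_pdivlMr; last by rewrite mulr_gt0 // ltr0n expn_gt0.
by move: mass_small; rewrite /level_mass; lra.
Qed.

(** Quasi-independence. An interval of level [l] meeting the one about [p] has its centre within
    [2 rho_k] of that of [p]. Such centres are [1 / Q_l^2] apart, so there are at most
    [8 rho_k Q_l^2] of them, each giving length [2 rho_l]; level [k] has at most [Q_k^2] fractions
    [p]. *)
Lemma near_fracs_overlap (R : realType) (rho : nat -> R) (k l : nat) :
  (forall i, 0 < rho i) -> {homo rho : i j / (i <= j)%N >-> j <= i} ->
  level_mass R rho k <= 256^-1 -> (k < l)%N ->
  (lebesgue_measure (near_fracs R rho k `&` near_fracs R rho l) <=
    (16 * level_mass R rho k * level_mass R rho l)%:E)%E.
Proof.
move=> rho_gt0 rho_noninc mass_small kl.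
have Q_gt0 i : 0 < (4 ^ i.+1)%:R :> R by rewrite ltr0n expn_gt0.
have mass_gt0 i : 0 < level_mass R rho i by rewrite mulr_gt0 ?exprn_gt0.
have one p : p \in fracs k ->
  (lebesgue_measure (near_frac R (rho k) p `&` near_fracs R rho l)
     <= (16 * rho k * level_mass R rho l)%:E)%E.
  move=> ps; pose s := [seq p' <- fracs l | `|frac_val R p' - frac_val R p| <= 2 * rho k].
  have us : uniq s by rewrite filter_uniq // fracs_uniq.
  have sE p' : p' \in s -> p' \in fracs l /\ `|frac_val R p' - frac_val R p| <= 2 * rho k.
    by rewrite mem_filter => /andP[].
  apply: (@le_trans _ _ (lebesgue_measure (\big[setU/set0]_(p' <- s)
      near_frac R (rho l) p'))).
    apply: le_measure; rewrite ?inE.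
    - by apply: measurableI; [exact: near_frac_measurable|exact: near_fracs_measurable].
    - by apply: bigsetU_measurable => p' _; exact: near_frac_measurable.
    move=> x []; rewrite near_fracE => xp /near_fracsP[p' p's xp'].
    rewrite -bigcup_seq; exists p' => /=; last by rewrite near_fracE.
    rewrite mem_filter p's andbT; move: xp xp'.
    by rewrite !ler_norml; have := rho_noninc k l (ltnW kl); lra.
  apply: le_trans (measure_bigsetU_le _ _ _ _ _ _ _ _) _.
    by move=> p'; exact: near_frac_measurable.
  rewrite (eq_bigr (fun=> (2 * rho l)%:E)); last first.
    by move=> p' _; apply: near_frac_measure; exact: ltW.
  rewrite sumEFin lee_fin big_const_seq count_predT iter_addr_0 -mulr_natr.
  suff ss : (size s)%:R <= 8 * rho k * (4 ^ l.+1)%:R ^+ 2.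
    by rewrite /level_mass; have := rho_gt0 l; nra.
  have rk := rho_gt0 k.
  have Ql := Q_gt0 l; have Qk := Q_gt0 k.
  case E : s => [|p' s']; first by rewrite mulr_ge0 // ?sqr_ge0 // mulr_ge0 // ltW.
  have /sE[p's near] : p' \in s by rewrite E mem_head.
  rewrite -E.
  have pp' : p != p'.
    apply/eqP => pE; move: ps p's; rewrite pE !mem_fracs.
    move=> /andP[_ h1] /andP[/and4P[_ _ h2 _] _].
    have := leq_trans h2 h1; rewrite ltn_exp2l // ltnS => h3.
    by move: kl; rewrite ltnNge h3.
  (* If the neighbourhood of [p] meets level [l] at all, the separation of [p] and
   [p'] forces [2 rho_k Q_k Q_l >= 1], which absorbs the [+ 1] in the count. *)
  have := fracs_sep R k l p p' ps p's pp'; rewrite distrC => /le_trans/(_ near).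
  rewrite -[leLHS]mul1r ler_pdivrMr ?mulr_gt0 // => big1.
  have sep : {in s &, forall i j, i != j -> ((4 ^ l.+1)%:R ^+ 2)^-1 <= `|frac_val R i - frac_val R j|}.
    move=> i j /sE[si _] /sE[sj _] ij; rewrite expr2; exact: fracs_sep si sj ij.
  have D0 : 0 < ((4 ^ l.+1)%:R ^+ 2 : R)^-1 by rewrite invr_gt0 exprn_gt0.
  have h0 : 0 <= 2 * rho k by rewrite mulr_ge0 // ltW.
  have sp : {in s, forall i, `|frac_val R i - frac_val R p| <= 2 * rho k} by move=> i /sE[].
  have := size_separated R _ s (frac_val R) (frac_val R p) (2 * rho k) _ us D0 h0 sp sep.
  rewrite invrK => /le_trans; apply.
  suff : 1 <= 4 * rho k * (4 ^ l.+1)%:R ^+ 2 by lra.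
  have sq1 : 1 <= (2 * rho k * ((4 ^ k.+1)%:R * (4 ^ l.+1)%:R)) ^+ 2 by rewrite exprn_ege1.
  apply: (le_trans sq1).
  have -> : (2 * rho k * ((4 ^ k.+1)%:R * (4 ^ l.+1)%:R)) ^+ 2 =
    level_mass R rho k * (4 * rho k * (4 ^ l.+1)%:R ^+ 2) by rewrite /level_mass; ring.
  apply: ler_piMl; first by rewrite mulr_ge0 ?sqr_ge0 // mulr_ge0 // ltW.
  by apply: le_trans mass_small _; lra.
rewrite {1}/near_fracs big_distrl /=.
apply: le_trans (measure_bigsetU_le _ _ _ _ _ _ _ _) _.
  by move=> p; apply: measurableI; [exact: near_frac_measurable|exact: near_fracs_measurable].
rewrite big_seq; apply: le_trans (lee_sum _ one) _.
rewrite -big_seq sumEFin lee_fin big_const_seq count_predT iter_addr_0 -[leLHS]mulr_natr.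
have : (size (fracs k))%:R <= (4 ^ k.+1)%:R ^+ 2 :> R.
  by rewrite -natrX ler_nat size_fracs_le.
have -> : 16 * level_mass R rho k * level_mass R rho l = 16 * rho k * level_mass R rho l * (4 ^ k.+1)%:R ^+ 2.
  by rewrite /level_mass; ring.
by apply: ler_wpM2l; rewrite !mulr_ge0 // ltW.
Qed.

(* Bonferroni, one level at a time. *)
Lemma near_fracs_union_ge (R : realType) (rho : nat -> R) (K n : nat) :
  (forall k, 0 < rho k) -> {homo rho : k l / (k <= l)%N >-> l <= k} ->
  (forall k, level_mass R rho k <= 256^-1) ->
  let E := \sum_(K <= k < n) level_mass R rho k in
  ((E / 4 - 8 * E ^+ 2)%:E <=
    lebesgue_measure (\big[setU/set0]_(K <= k < n) near_fracs R rho k))%E.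
Proof.
move=> rho_gt0 rho_noninc mass_small /=; elim: n => [|n IH]; first by rewrite !big_geq // measure0 lee_fin; lra.
have [Kn|nK] := leqP K n; last by rewrite !big_geq // measure0 lee_fin; lra.
rewrite !big_nat_recr //=; set E := \sum_(K <= k < n) _ in IH *.
(* With [m] the mass of level [n], the bound [16 E m] is the cross term of [8 (E + m)^2]. *)
have ov : (lebesgue_measure ((\big[setU/set0]_(K <= k < n) near_fracs R rho k) `&`
    near_fracs R rho n) <= (16 * E * level_mass R rho n)%:E)%E.
  rewrite big_distrl /=; apply: le_trans (measure_bigsetU_le _ _ _ _ _ _ _ _) _.
    by move=> k; apply: measurableI; exact: near_fracs_measurable.
  rewrite mulr_sumr mulr_suml -sumEFin big_nat_cond [leRHS]big_nat_cond.
  by apply: lee_sum => k /andP[/andP[_ kn] _]; exact: near_fracs_overlap.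
apply: le_trans (measureU_lower _ _ _ _ _ _ _ _ _ _ _ IH (near_fracs_measure_ge _ _ _ (rho_gt0 n) (mass_small n)) ov).
- rewrite lee_fin; have : 0 < level_mass R rho n by rewrite mulr_gt0 // exprn_gt0 // ltr0n expn_gt0.
  nra.
- by apply: bigsetU_measurable => k _; exact: near_fracs_measurable.
exact: near_fracs_measurable.
Qed.

(** The tail unions [V K] decrease, lie in [[0, 1)] and have measure at least [1 / 1024]; continuity
    from above passes this bound on to their intersection. *)
Lemma limsup_near_fracs_not_negligible (R : realType) (rho : nat -> R) :
  (forall k, 0 < rho k) -> {homo rho : k l / (k <= l)%N >-> l <= k} ->
  (forall k, level_mass R rho k <= 256^-1) ->
  (forall (K : nat) (T : R), exists n : nat, T < \sum_(K <= k < n) level_mass R rho k) ->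
  ~ (@lebesgue_measure R).-negligible
      [set x | forall K : nat, exists2 k, (K <= k)%N & near_fracs R rho k x].
Proof.
move=> rho_gt0 rho_noninc mass_small mass_div.
have mF k : measurable (near_fracs R rho k) by exact: near_fracs_measurable.
pose V K := \bigcup_(k in [set k | (K <= k)%N]) near_fracs R rho k.
have mV K : measurable (V K) by apply: bigcup_measurable.
have VE : [set x | forall K : nat, exists2 k, (K <= k)%N & near_fracs R rho k x] =
    \bigcap_K V K.
  by apply/seteqP; split => x /= h K; [move=> _; exact: h|exact: (h K I)].
rewrite VE => -[B [mB B0 VB]].
have mu0 : lebesgue_measure (\bigcap_K V K) = 0%E :> \bar R.
  apply/eqP; rewrite eq_le measure_ge0 andbT -B0.
  by apply: le_measure; rewrite ?inE //; exact: bigcapT_measurable.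
have V_ge K : ((1024^-1)%:E <= lebesgue_measure (V K) :> \bar R)%E.
  (* The bound [E / 4 - 8 E^2] is negative once [E] exceeds [1 / 32], so overshooting must be
     avoided. For the least such [n], [E] lies between [1 / 128] and [1 / 128 + 1 / 256], where the
     bound exceeds [1 / 1024]. *)
  have [n En nmin] := ex_minnP (mass_div K 128^-1).
  have Kn : (K < n)%N.
    rewrite ltnNge; apply/negP => nK; move: En; rewrite big_geq //; lra.
  case: n Kn En nmin => // n Kn En nmin.
  have En' : \sum_(K <= k < n) level_mass R rho k <= 128^-1.
    by rewrite leNgt; apply/negP => /nmin; rewrite ltnn.
  apply: (@le_trans _ _ (lebesgue_measure
      (\big[setU/set0]_(K <= k < n.+1) near_fracs R rho k))).
    apply: le_trans _ (near_fracs_union_ge _ _ _ _ rho_gt0 rho_noninc mass_small).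
    rewrite lee_fin; move: En; rewrite big_nat_recr //=.
    by move: (mass_small n); nra.
  apply: le_measure; rewrite ?inE.
  - by apply: bigsetU_measurable => k _; exact: mF.
  - exact: mV.
  rewrite -bigcup_seq => x [k /=]; rewrite mem_index_iota => /andP[Kk _] xk.
  by exists k.
have V0 : (lebesgue_measure (V 0%N) < +oo :> \bar R)%E.
  apply: (@le_lt_trans _ _ (lebesgue_measure (`[0, 1]%classic : set R))).
    apply: le_measure; rewrite ?inE; [exact: mV|exact: measurable_itv|].
    move=> x [k _ /near_fracs_sub01] /(_ (mass_small k)) /andP[x0 x1].
    by rewrite /= in_itv /= x0 ltW.
  by rewrite lebesgue_measure_itv /= lte_fin ltr01 -EFinB ltry.
have V_noninc : {homo V : n m / (n <= m)%N >-> (m <= n)%O}.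
  move=> K L KL; apply/subsetPset => x [k /= Lk xk]; exists k => //=.
  exact: leq_trans KL Lk.
have cv : (lebesgue_measure \o V) @ \oo --> (0%E : \bar R).
  by rewrite -mu0; exact: nonincreasing_cvg_mu V0 mV (bigcapT_measurable mV) V_noninc.
have : ((1024^-1)%:E <= limn (lebesgue_measure \o V) :> \bar R)%E.
  by apply: lime_ge; [apply/cvg_ex; exists 0%E|apply: nearW => K; exact: V_ge].
by rewrite (cvg_lim _ cv) // lee_fin; lra.
Qed.

(** * Condensation and failure of the Poissonian limit *)

Definition near_radius (R : realType) (a : nat -> nat) (k : nat) : R :=
  ((4 ^ k.+3)%:R * (a (4 ^ k.+3)%N)%:R)^-1.

Lemma level_mass_near_radius (R : realType) (a : nat -> nat) (k : nat) :
  level_mass R (near_radius R a) k = (4 ^ k.+1)%:R / (16 * (a (4 ^ k.+3)%N)%:R).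
Proof.
rewrite /level_mass /near_radius.
have -> : (4 ^ k.+3)%:R = 16 * (4 ^ k.+1)%:R :> R.
  by rewrite -natrM; congr _%:R; rewrite 2!expnS mulnA.
have Q0 : (4 ^ k.+1)%:R != 0 :> R by rewrite pnatr_eq0 -lt0n expn_gt0.
have [->|a0] := eqVneq ((a (4 ^ k.+3)%N)%:R : R) 0; first by rewrite !mulr0 invr0 mulr0 mul0r.
by field; rewrite a0 Q0.
Qed.

(** Cauchy condensation with ratio 4. The first [4^3 = 64] terms are at most 1 each. The block from
    [N = 4^(m+3)] to [4 N] has [48 * 4^(m+1)] terms, each at most [1 / a N], which is
    [48 * 16 = 768] times the mass of level [m]. *)
Lemma sum_inv_condensation (R : realType) (a : nat -> nat) (m : nat) :
  {homo a : m n / (m < n)%N} ->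
  \sum_(n < 4 ^ m.+3) ((a n)%:R)^-1 <=
    64 + 768 * \sum_(k < m) level_mass R (near_radius R a) k :> R.
Proof.
move=> ha; have am := homo_ltn_geq a _ ha.
elim: m => [|m IH].
  rewrite big_ord0 mulr0 addr0; apply: le_trans (_ : \sum_(n < 4 ^ 3) 1 <= _); last first.
    by rewrite sumr_const card_ord.
  apply: ler_sum => n _; have [->|an] := posnP (a n); first by rewrite invr0.
  by rewrite invf_le1 ?ltr0n // ler1n.
rewrite big_ord_recr /= -(big_mkord xpredT (fun n => (a n)%:R^-1)).
rewrite (big_cat_nat _ (n := (4 ^ m.+3)%N)) //=; last by rewrite leq_exp2l.
rewrite big_mkord mulrDr addrA lerD //.
rewrite level_mass_near_radius; set N := (4 ^ m.+3)%N.
have NE : N = (16 * 4 ^ m.+1)%N by rewrite /N 2!expnS mulnA.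
have aN0 : 0 < (a N)%:R :> R.
  by rewrite ltr0n (leq_trans _ (am N)) // expn_gt0.
apply: (@le_trans _ _ (\sum_(N <= n < 4 ^ m.+4) ((a N)%:R)^-1)).
  rewrite big_nat_cond [leRHS]big_nat_cond; apply: ler_sum => n /andP[/andP[Nn _] _].
  rewrite lef_pV2 ?posrE //; first by rewrite ler_nat (ltnW_homo ha).
  by rewrite ltr0n (leq_trans _ (am n)) // (leq_trans _ Nn) // expn_gt0.
rewrite sumr_const_nat.
have -> : (4 ^ m.+4 - N = 48 * 4 ^ m.+1)%N.
  by rewrite NE expnS -/N NE; lia.
rewrite -[leLHS]mulr_natr natrM le_eqVlt; apply/orP; left; apply/eqP.
by field; rewrite lt0r_neq0.
Qed.

(* An entry [a 0 = 0] contributes [0^-1 = 0] to the sum. *)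
Lemma not_mppc_of_divergent_inv_sum (R : realType) (a : nat -> nat) :
  {homo a : m n / (m < n)%N} ->
  (forall T : R, exists M : nat, T < \sum_(n < M) ((a n)%:R)^-1) ->
  ~ mppc R a.
Proof.
move=> ha div; have am n := homo_ltn_geq a n ha.
have le4 n : (n <= 4 ^ n.+3)%N.
  by rewrite (leq_trans (ltnW (ltn_expl n (isT : 1 < 4)%N))) // leq_exp2l // -addn3 leq_addr.
have N0 k : (0 < 4 ^ k.+3)%N by rewrite expn_gt0.
have aN0 k : (0 < a (4 ^ k.+3))%N by exact: leq_trans (N0 k) (am _).
have ale : {homo a : m n / (m <= n)%N} by move=> m n; rewrite leq_eqVlt => /orP[/eqP -> //|/ha /ltnW].
pose rho := near_radius R a.
have rho_gt0 k : 0 < rho k by rewrite invr_gt0 mulr_gt0 // ltr0n.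
have rho_noninc : {homo rho : k l / (k <= l)%N >-> l <= k}.
  move=> k l kl; rewrite /rho /near_radius lef_pV2 ?posrE ?mulr_gt0 ?ltr0n //.
  by rewrite ler_pM // ler_nat ?ale // leq_exp2l.
(* The threshold [1 / 256] comes from [a N >= N = 16 Q], the mass being [Q / (16 * a N)]. *)
have mass_small k : level_mass R rho k <= 256^-1.
  rewrite level_mass_near_radius ler_pdivrMr ?mulr_gt0 ?ltr0n //.
  have : (16 * 4 ^ k.+1)%:R <= (a (4 ^ k.+3)%N)%:R :> R.
    rewrite ler_nat; apply: leq_trans (am _).
    by have -> : (4 ^ k.+3 = 16 * 4 ^ k.+1)%N by rewrite 2!expnS mulnA.
  rewrite natrM; lra.
have mass_div (K : nat) (T : R) : exists n : nat, T < \sum_(K <= k < n) level_mass R rho k.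
  (* Adding the first [K] masses to the target leaves more than [T] for the tail. *)
  have [M MP] := div (64 + 768 * (\sum_(0 <= k < K) level_mass R rho k + T)).
  exists (maxn K M); have := sum_inv_condensation R a (maxn K M) ha.
  rewrite -/rho -(big_mkord xpredT (level_mass R rho)).
  rewrite (big_cat_nat _ (n := K)) //= ?leq_maxl // => h.
  have {h} := le_trans _ h => /(_ (\sum_(n < M) ((a n)%:R)^-1)) h.
  suff /h : \sum_(n < M) ((a n)%:R)^-1 <= \sum_(n < 4 ^ (maxn K M).+3) ((a n)%:R)^-1 :> R.
    by move: MP; lra.
  have M4 : (M <= 4 ^ (maxn K M).+3)%N.
    exact: leq_trans (leq_maxr K M) (le4 _).
  rewrite -!(big_mkord xpredT (fun n => ((a n)%:R : R)^-1)).
  by rewrite [leRHS](big_cat_nat _ (n := M)) //= lerDl sumr_ge0.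
move=> pc; apply: (limsup_near_fracs_not_negligible R rho rho_gt0 rho_noninc mass_small mass_div).
case: pc => B [mB B0 PB]; exists B; split => // x /= xlim; apply: PB => /= xP.
(* Membership at some level places [x] in [[0, 1)]. *)
have [k0 _ xk0] := xlim 0%N.
(* At [s = 1] the limit is 2, so the ratio is eventually below 3; the levels supplied by [xlim] give
   at least [16 - 1 = 15], the 1 being lost to the diagonal. *)
have /xP/(_ 1 ler01) := near_fracs_sub01 _ _ _ _ (mass_small k0) xk0.
move/cvgrPdist_lt => /(_ 1 ltr01) [K _ KP].
have [k Kk /near_fracsP[[r q]]] := xlim K; rewrite mem_fracs => /andP[/and4P[/= r0 rq _ _] qQ].
rewrite /frac_val /= => xrq.
set N := (4 ^ k.+3)%N in xrq.
have KN : (K <= N)%N.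
  exact: leq_trans Kk (le4 _).
have qN : (16 * q <= N)%N by rewrite /N expnS expnS mulnA leq_mul2l.
have := pair_count_near_rational R a x q r 16 N ha (ltn_trans r0 rq) qN xrq.
have NR : 0 < N%:R :> R by rewrite ltr0n N0.
rewrite -(ler_nat R) natrD natrM => cnt.
have := KP N KN; rewrite /= ltr_norml => /andP[+ _].
have : 15 <= (pair_count a x 1 N)%:R / N%:R :> R by rewrite ler_pdivlMr //; lra.
lra.
Qed.

Theorem theorem1p3 (R : realType) (a : nat -> nat)
    (ha : enumerates a [set k : nat | (0 < k)%N /\ sum_of_two_squares k]) :
  ~ mppc R a.
Proof.
apply: not_mppc_of_divergent_inv_sum; first exact: ha.1.
by move=> T; exact: sum_inv_enum_unbounded.
Qed.
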